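(* There exists $N$ such that for every $n\ge N$ there exist $0<\beta_-(n)\le\beta_+(n)<\infty$ with the following property: for the Arboreal Gas with uniform parameter $\beta$ on the complete graph $K_n$ with $n$ vertices, for every $\beta>0$ with $\beta\le\beta_-(n)$ or $\beta\ge\beta_+(n)$ and every pair of distinct edges $e_1,e_2$ of $K_n$, $$\mathbb{P}_\beta[e_1e_2]\le \mathbb{P}_\beta[e_1]\,\mathbb{P}_\beta[e_2].$$
   Context: A forest on a finite graph $G$ is a subgraph (identified with its set of edges) containing no cycle; $\mathcal{F}$ is the set of all forests on $G$. The Arboreal Gas with uniform parameter $\beta>0$ is the probability measure on $\mathcal F$ given by $\mathbb{P}_\beta[F]=\frac{1}{Z_\beta}\beta^{|F|}$, with $Z_\beta=\sum_{F\in\mathcal F}\beta^{|F|}$, where $|F|$ is the number of edges of $F$. For edges $e_1,\dots,e_k$, $\mathbb{P}_\beta[e_1\cdots e_k]$ denotes the probability that all of $e_1,\dots,e_k$ belong to the random forest. *)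

(* Defs.v *)
From mathcomp Require Import all_boot all_order all_algebra.
From mathcomp Require Import reals.

Set Implicit Arguments.
Unset Strict Implicit.
Unset Printing Implicit Defensive.

Import Order.TTheory GRing.Theory Num.Theory.

Local Open Scope ring_scope.

(* A simple graph on the vertex type T is given by its set E of edges, an edge
   being the two-element set of its endpoints; a subgraph is a subset of E. *)

Definition complete_edges (T : finType) : {set {set T}} :=
  [set e : {set T} | #|e| == 2%N].

Definition edge_rel (T : finType) (F : {set {set T}}) : rel T :=
  fun x y => [set x; y] \in F.

(* The size condition excludes the closed walks x, y, x that go back and forth
   along one edge.  Bounding the size of c by #|T| keeps the predicate boolean
   and loses no cycle, see acyclicP. *)
Definition acyclic (T : finType) (F : {set {set T}}) : bool :=
  ~~ [exists k : 'I_#|T|.+1, exists c : k.-tuple T,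
        (2 < size c)%N && ucycleb (edge_rel F) c].

Lemma acyclicP (T : finType) (F : {set {set T}}) :
  reflect (forall c : seq T, (2 < size c)%N -> ~ ucycle (edge_rel F) c)
          (acyclic F).
Proof.
apply: (iffP idP) => [/existsPn noc c c3 cF | noc].
  have /andP[_ cU] := cF.
  have ck : (size c < #|T|.+1)%N by rewrite ltnS -(card_uniqP cU) max_card.
  move/existsPn: (noc (Ordinal ck)) => /(_ (in_tuple c)) /negP; apply.
  by apply/andP; split.
apply/existsP => -[k /existsP[c /andP[c3 cF]]]; exact: noc c3 cF.
Qed.

Definition forests (T : finType) (E : {set {set T}}) : {set {set {set T}}} :=
  [set F : {set {set T}} | (F \subset E) && acyclic F].

Section ArborealGas.
Variables (R : realType) (T : finType) (E : {set {set T}}) (beta : R).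

Definition ag_partition : R := \sum_(F in forests E) beta ^+ #|F|.

Definition ag_mass (F : {set {set T}}) : R := beta ^+ #|F| / ag_partition.

Definition ag_prob (A : pred {set {set T}}) : R :=
  \sum_(F in forests E | A F) ag_mass F.

Definition ag_edges (es : seq {set T}) : R :=
  ag_prob (fun F => all (fun e => e \in F) es).

Lemma forests0 : set0 \in forests E.
Proof.
rewrite inE sub0set; apply/acyclicP => -[|x [|y c]] //= _ /andP[].
by rewrite /= /edge_rel inE.
Qed.

Lemma ag_partition_gt0 : 0 < beta -> 0 < ag_partition.
Proof.
move=> b0; rewrite /ag_partition (bigD1 set0) ?forests0 //= cards0 expr0.
by rewrite ltr_wpDr ?ltr01 // sumr_ge0 // => F _; rewrite exprn_ge0 ?ltW.
Qed.

Lemma ag_prob1 : 0 < beta -> ag_prob predT = 1.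
Proof.
move=> b0; rewrite /ag_prob; under eq_bigl do rewrite andbT.
by rewrite -mulr_suml divff // gt_eqF // ag_partition_gt0.
Qed.

End ArborealGas.

(* Main.v *)
(* After multiplication by the square of the partition function, the claim says
   that Q = p12 p0 - p1 p2 is nonpositive at beta, where p_W(beta) is the sum of
   beta^|G| over the forests G containing W.  It is enough that the extreme
   nonzero coefficients of Q are negative.  They are computed from one recursion
   on the number N_k(F) of k-edge forests containing a forest F: counting the
   ordered pairs (x, y) such that xy is an edge of G \ F gives
     2 (k - |F|) N_k(F) = sum of N_k(F + xy) over x, y not connected in F.
   If F has components of sizes a_1, ..., a_c then, by induction on c,
     N_{n-1}(F) = n^(c-2) prod a_i,
     N_{n-2}(F) = n^(c-4) prod a_i (n sum 1/a_i - binom(c-2, 2)),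
   and two steps of the recursion express N_{|F|+1}(F) and N_{|F|+2}(F) by
   power sums of the a_i.  For adjacent edges the leading coefficients at both
   ends are already negative.  For disjoint edges the lowest coefficient that
   survives is the one of beta^4, equal to -2, and at the top the one of
   beta^(2n-2) vanishes while the one of beta^(2n-3) has the sign of minus the
   second difference of binom(m, 2), which is -1. *)

Require Import Defs.
From mathcomp Require Import all_boot all_order all_algebra.
From mathcomp Require Import reals ring lra zify.

Set Implicit Arguments.
Unset Strict Implicit.
Unset Printing Implicit Defensive.

Import Order.TTheory GRing.Theory Num.Theory.

Local Open Scope ring_scope.

(** * Connectivity and acyclicity when an edge is inserted *)

Section Components.
Variable T : finType.
Implicit Types (F G : {set {set T}}) (x y u v : T) (A B : {set T}).

Definition conn F := connect (edge_rel F).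
Definition component F x := [set y | conn F x y].
Definition blocks F := [set component F x | x in T].

Lemma conn_sym F x y : conn F x y = conn F y x.
Proof. by apply: sym_connect_sym => u v; rewrite /edge_rel setUC. Qed.

Lemma conn_trans F x y z : conn F x y -> conn F y z -> conn F x z.
Proof. exact: connect_trans. Qed.

Lemma conn_sub F G x y : F \subset G -> conn F x y -> conn G x y.
Proof.
move=> /subsetP FG; apply: connect_sub => u v uv.
by apply/connect1/FG.
Qed.

Lemma set2_eq x y u v :
  ([set x; y] == [set u; v]) = (x == u) && (y == v) || (x == v) && (y == u).
Proof.
apply/eqP/idP => [E|/orP[]/andP[/eqP-> /eqP->] //]; last by rewrite setUC.
have: [/\ u \in [set x; y], v \in [set x; y], x \in [set u; v] &
  y \in [set u; v]].
  by rewrite E -{3 4}E !set21 !set22.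
rewrite !inE => -[].
case/orP=> /eqP ? /orP[]/eqP ? /orP[]/eqP ? /orP[]/eqP ?;
  by subst; rewrite ?eqxx ?orbT.
Qed.

(** A walk in F + xy can be shortened until it crosses xy at most once; the last two disjuncts are
    the two directions of that crossing. *)
Lemma conn_setU1 F x y u v : conn ([set x; y] |: F) u v =
  [|| conn F u v, conn F u x && conn F y v | conn F u y && conn F x v].
Proof.
apply/idP/idP => [|].
  move=> /connectP[p]; elim: p u => [|w p IH] u /=; first by move=> _ ->;
    rewrite /conn connect0.
  move=> /andP[uw /IH{}IH] /IH {IH}; move: uw;
    rewrite /edge_rel in_setU1 set2_eq.
  case/orP=> [/orP[]/andP[/eqP-> /eqP->]|/(@connect1 _ (edge_rel F)) uw].
  - by case/or3P=> [yv|/andP[_ yv]|/andP[_ xv]];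
      rewrite ?yv ?xv /conn ?connect0 ?orbT //.
  - by case/or3P=> [yv|/andP[_ yv]|/andP[_ xv]];
      rewrite ?yv ?xv /conn ?connect0 ?orbT //.
  - by case/or3P=> [|/andP[+ ->]|/andP[+ ->]] => /(conn_trans uw) ->;
    rewrite ?orbT.
have FG : F \subset [set x; y] |: F by apply: subsetUr.
have xy : conn ([set x; y] |: F) x y by apply: connect1;
  rewrite /edge_rel setU11.
case/or3P=> [/(conn_sub FG)//|/andP[/(conn_sub FG) a /(conn_sub FG) b]|
  /andP[/(conn_sub FG) a /(conn_sub FG) b]].
- exact: conn_trans (conn_trans a xy) b.
- by apply: conn_trans (conn_trans a _) b; rewrite conn_sym.
Qed.

(** Each step of the path ends at a vertex of [p], hence outside [e], so no step can be [e]
    itself. *)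
Lemma path_avoid F (e : {set T}) x p : path (edge_rel F) x p ->
  {in p, forall z, z \notin e} -> path (edge_rel (F :\ e)) x p.
Proof.
elim: p x => //= z p IH x /andP[xz zp] pe; apply/andP; split.
  rewrite /edge_rel in_setD1 [_ \in F]xz andbT.
  by apply: contraNneq (pe z (mem_head _ _)) => <-; rewrite set22.
by apply: IH => // w wp; apply: pe; rewrite inE wp orbT.
Qed.

(** An edge lies on a cycle exactly when its ends stay connected after its removal. This trades
    cycles for connectivity, which is easier to follow under edge insertion. *)
Lemma acyclic_bridgeP F :
  reflect (forall x y, x != y -> [set x; y] \in F ->
             ~~ conn (F :\ [set x; y]) x y)
          (acyclic F).
Proof.
apply: (iffP (acyclicP F)) => [ac x y nxy xyF|br c].
  apply/negP => /connectP[p]; case/shortenP => q qP qU _ yE.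
  apply: (ac (x :: q)).
    (* The shortened path closes up to a cycle through xy. It has at least three vertices, since a
       single step would be the deleted edge. *)
    case: q qP yE {qU} => [|z [|? ?]] //= => [_ yE|+ yE]; subst y.
      by rewrite eqxx in nxy.
    by rewrite /edge_rel setD11.
  rewrite /ucycle qU andbT /= rcons_path; apply/andP; split.
    by apply: sub_path qP => u v; rewrite /edge_rel in_setD1 => /andP[].
  by rewrite -yE /edge_rel setUC.
case: c => [|x [|y [|z p]]] // _ /andP[].
set q := z :: p => cF cU.
have [nxy xq yq] : [/\ x != y, x \notin q & y \notin q].
  by move: cU; rewrite /= inE negb_or => /and3P[/andP[? ?] ? ?].
move: cF; rewrite /= -/(path _ y (rcons q x)) => /andP[xyF].
rewrite -/(edge_rel F y z) => qP.
have {}qP : path (edge_rel F) y (rcons q x) by [].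
have /negP := br x y nxy xyF; apply.
move: qP; rewrite rcons_path => /andP[qP lx].
(* The rest of the cycle joins y to x: up to [last y q] it never returns to x or y, and the closing
   edge starts at a vertex other than x and y. *)
rewrite conn_sym; apply: conn_trans (_ : conn _ y (last y q)) _.
  apply/connectP; exists q => //; apply: path_avoid qP _ => w wq.
  by rewrite !inE negb_or; apply/andP; split; apply: contraTneq wq => ->.
have lq : last y q \in q by rewrite /q /= mem_last.
apply: connect1; rewrite /edge_rel in_setD1 [_ \in F]lx andbT.
apply: contraTneq lq => E.
have : last y q \in [set x; y] by rewrite -E set21.
by rewrite !inE => /orP[]/eqP->.
Qed.

Lemma acyclic_sub F G : F \subset G -> acyclic G -> acyclic F.
Proof.
move=> FG /acyclic_bridgeP ac; apply/acyclic_bridgeP => x y nxy xyF.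
apply: contra (ac x y nxy (subsetP FG _ xyF)).
by apply: conn_sub; apply: setSD.
Qed.

Lemma acyclic_setU1 F x y : x != y -> [set x; y] \notin F ->
  acyclic ([set x; y] |: F) = acyclic F && ~~ conn F x y.
Proof.
move=> nxy xyF; apply/idP/andP => [ac|[/acyclic_bridgeP ac nc]].
  split; first exact: acyclic_sub (subsetUr _ _) ac.
  move/acyclic_bridgeP: ac => /(_ x y nxy (setU11 _ _)); apply: contra.
  by apply: conn_sub; apply/subsetP => e eF; rewrite !inE eF orbT andbT;
     apply: contraNneq xyF => <-.
apply/acyclic_bridgeP => u v nuv; rewrite in_setU1 => /orP[/eqP uvE|uvF].
  have -> : ([set x; y] |: F) :\ [set u; v] = F by rewrite uvE setU1K.
  move/eqP: uvE; rewrite set2_eq => /orP[]/andP[/eqP-> /eqP->] //.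
  by rewrite conn_sym.
have -> : ([set x; y] |: F) :\ [set u; v] = [set x; y] |: (F :\ [set u; v]).
  apply/setP => e; rewrite !inE; case: (eqVneq e [set x; y]) => //= ->.
  by rewrite andbT; apply: contraNneq xyF => ->.
rewrite conn_setU1 (negbTE (ac u v nuv uvF)) /=.
have sF : F :\ [set u; v] \subset F by apply: subsetDl.
have uv : conn F u v by apply: connect1.
(* If u and v were joined through xy, then x and y would be joined in F through uv. *)
apply: contra nc => /orP[]/andP[/(conn_sub sF) a /(conn_sub sF) b].
  rewrite conn_sym in a; rewrite conn_sym in b.
  by apply: conn_trans a (conn_trans uv b).
by rewrite conn_sym; apply: conn_trans (conn_trans _ uv) _;
   rewrite conn_sym //.
Qed.

End Components.

(** * The partition of the vertices into components, and sums over it *)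

Section Blocks.
Variable T : finType.
Implicit Types (F G : {set {set T}}) (x y u v : T) (A B : {set T}).

Lemma component_eq F x y : (component F x == component F y) = conn F x y.
Proof.
apply/eqP/idP => [/setP/(_ y)|xy]; first by rewrite !inE => ->; apply: connect0.
apply/setP => z; rewrite !inE; apply/idP/idP; last exact: conn_trans.
by apply: conn_trans; rewrite conn_sym.
Qed.

Lemma mem_blocks F x : component F x \in blocks F.
Proof. exact: imset_f. Qed.

Lemma blocks_setU1 F x y : ~~ conn F x y ->
  blocks ([set x; y] |: F) =
  (component F x :|: component F y)
    |: (blocks F :\ component F x :\ component F y).
Proof.
move=> nxy.
have cU z : component ([set x; y] |: F) z =
    if conn F z x || conn F z y then component F x :|: component F y else
      component F z.
  apply/setP => w; rewrite inE conn_setU1.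
  case: ifP => [|/norP[/negbTE-> /negbTE->]]; last by rewrite !inE orbF.
  rewrite !inE => /orP[zx|zy].
  - have -> : conn F z y = false.
      apply: contraNF nxy => zy; apply: conn_trans zy.
      by rewrite conn_sym.
    rewrite zx orbF /=; congr (_ || _).
    by rewrite -!/(_ \in component F _); move: zx;
      rewrite -component_eq => /eqP /setP/(_ w); rewrite !inE.
  - have -> : conn F z x = false.
      apply: contraNF nxy => zx; rewrite conn_sym in zx;
        exact: conn_trans zx zy.
    rewrite zy /= orbC; congr (_ || _).
    by move: zy; rewrite -component_eq => /eqP /setP/(_ w); rewrite !inE.
apply/setP => C; rewrite !inE; apply/imsetP/idP.
  case=> z _ ->; rewrite cU; case: ifP => [_|/norP[zx zy]];
    first by rewrite eqxx.
  by rewrite mem_blocks andbT !component_eq zx zy orbT.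
case/orP => [/eqP->|/and3P[Cy Cx /imsetP[z _ zE]]].
  by exists x => //; rewrite cU /conn connect0.
exists z => //; rewrite cU zE; subst C.
by move: Cx Cy; rewrite !component_eq => /negbTE-> /negbTE->.
Qed.

(** Two blocks are replaced by their union. Stated without inverses, so that it serves sums,
    products and the number of blocks alike. *)
Lemma bigop_blocks_setU1 (S : Type) (idx : S) (op : Monoid.com_law idx)
    (g : nat -> S) F x y : ~~ conn F x y ->
  op (op (g #|component F x|) (g #|component F y|))
     (\big[op/idx]_(C in blocks ([set x; y] |: F)) g #|C|) =
  op (g (#|component F x| + #|component F y|)%N)
     (\big[op/idx]_(C in blocks F) g #|C|).
Proof.
move=> nxy; rewrite blocks_setU1 // big_setU1 /=; last first.
  (* The union is not already a block of F, for such a block would connect x to y. *)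
  apply/negP; rewrite !inE => /and3P[_ _ /imsetP[z _ zE]].
  have xz : conn F z x.
    by move/setP: zE => /(_ x); rewrite !inE /conn connect0.
  have yz : conn F z y.
    by move/setP: zE => /(_ y); rewrite !inE /conn connect0 orbT.
  by move/negP: nxy; apply; rewrite conn_sym in xz; apply: conn_trans xz yz.
have dAB : component F x :&: component F y = set0.
  apply/setP => z; rewrite !inE; apply: contraNF nxy => /andP[xz yz].
  by rewrite conn_sym in yz; apply: conn_trans xz yz.
rewrite cardsU dAB cards0 subn0.
rewrite [in RHS](big_setD1 (component F x)) ?mem_blocks //=.
rewrite [in RHS](big_setD1 (component F y)) /=; last first.
  by rewrite !inE mem_blocks eq_sym component_eq nxy.
by rewrite Monoid.mulmCA -Monoid.mulmA.
Qed.

Section Sums.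
Variable R : numFieldType.

Lemma sum_vertices_blocks F (g : {set T} -> R) :
  \sum_x g (component F x) = \sum_(A in blocks F) #|A|%:R * g A.
Proof.
rewrite (partition_big (component F) (mem (blocks F))) /=; last first.
  by move=> x _; apply: mem_blocks.
apply: eq_bigr => _ /imsetP[z _ ->].
rewrite (eq_bigl (mem (component F z))) => [|x]; last first.
  by rewrite /= component_eq inE conn_sym.
rewrite (eq_bigr (fun=> g (component F z))) ?sumr_const ?mulr_natl // => x.
by rewrite !inE -component_eq => /eqP->.
Qed.

(** All ordered pairs of vertices, grouped by their blocks, minus the pairs inside one block. *)
Lemma sum_disconnected_pairs F (phi : R -> R -> R) :
  \sum_x \sum_(y | ~~ conn F x y) phi #|component F x|%:R #|component F y|%:R =
  \sum_(A in blocks F) \sum_(B in blocks F)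
     #|A|%:R * #|B|%:R * phi #|A|%:R #|B|%:R
  - \sum_(A in blocks F) #|A|%:R ^+ 2 * phi #|A|%:R #|A|%:R.
Proof.
have inner x : \sum_(y | ~~ conn F x y) phi
      #|component F x|%:R #|component F y|%:R =
    \sum_(B in blocks F) #|B|%:R * phi #|component F x|%:R #|B|%:R
    - #|component F x|%:R * phi #|component F x|%:R #|component F x|%:R.
  rewrite -(sum_vertices_blocks F (fun B => phi #|component F x|%:R #|B|%:R)).
  rewrite [in RHS](bigID (conn F x)) /= addrC -[LHS]addr0 -addrA; congr (_ + _).
  rewrite (eq_bigr (fun=> phi #|component F x|%:R #|component F x|%:R)) => [|y].
    rewrite sumr_const mulr_natl
      -[X in _ = _ *+ X - _](_ : #|component F x| = _).
      by rewrite subrr.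
    by apply: eq_card => y; rewrite inE.
  by rewrite -component_eq => /eqP->.
rewrite (eq_bigr _ (fun x _ => inner x)) sumrB.
rewrite (sum_vertices_blocks F (fun A => #|A|%:R * phi #|A|%:R #|A|%:R)).
rewrite (sum_vertices_blocks F
  (fun A => \sum_(B in blocks F) #|B|%:R * phi #|A|%:R #|B|%:R)).
congr (_ - _); apply: eq_bigr => A _; last by rewrite mulrA.
by rewrite mulr_sumr; apply: eq_bigr => B _; rewrite mulrA.
Qed.

End Sums.
End Blocks.

(** * Counting the forests that contain a given forest *)

Section Counting.
Variable T : finType.
Implicit Types (F G : {set {set T}}) (x y u v : T) (A B : {set T}).

Local Notation forest F := (F \in forests (complete_edges T)).

(** This is N_k(F); [k] counts the edges of [F] too. *)
Definition nforests k F :=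
  #|[set G in forests (complete_edges T) | (F \subset G) && (#|G| == k)]|.

Lemma mem_complete_edges x y : ([set x; y] \in complete_edges T) = (x != y).
Proof. by rewrite inE cards2; case: (x != y). Qed.

Lemma forest_sub F G : F \subset G -> forest G -> forest F.
Proof.
rewrite !inE => FG /andP[GK Ga].
by rewrite (subset_trans FG GK) (acyclic_sub FG Ga).
Qed.

Lemma connP_neq F x y : ~~ conn F x y -> (x != y) /\ ([set x; y] \notin F).
Proof.
move=> nc; split; first by apply: contraNneq nc => ->; apply: connect0.
by apply: contra nc => xyF; apply: connect1.
Qed.

Lemma forest_setU1 F x y : ~~ conn F x y ->
  forest ([set x; y] |: F) = forest F.
Proof.
move=> nc; have [nxy xyF] := connP_neq nc.
by rewrite !inE subUset sub1set mem_complete_edges nxy acyclic_setU1 //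
  nc andbT.
Qed.

Lemma forest_edge_disconnects F x y : forest F -> [set x; y] \in F ->
  ~~ conn (F :\ [set x; y]) x y.
Proof.
rewrite inE => /andP[/subsetP FK /acyclic_bridgeP ac] xyF.
by apply: ac => //; rewrite -mem_complete_edges FK.
Qed.

Lemma complete_edgeP (e : {set T}) : e \in complete_edges T ->
  exists x y, x != y /\ e = [set x; y].
Proof. by rewrite inE => /cards2P[x [y [? ?]]]; exists x, y. Qed.

Lemma card_blocks_setU1 F x y : ~~ conn F x y ->
  #|blocks F| = #|blocks ([set x; y] |: F)|.+1.
Proof.
move=> nc; have /= := bigop_blocks_setU1 addn (fun=> 1%N) nc.
by rewrite !sum1_card !add2n !add1n => -[].
Qed.

Lemma blocks0 : blocks set0 = [set [set x] | x in T].
Proof.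
apply: eq_imset => x; apply/setP => y; rewrite !inE eq_sym.
apply/idP/eqP => [/connectP[[|z p] /=]|<-]; last exact: connect0.
  by move=> _ ->.
by rewrite /edge_rel inE.
Qed.

(** Deleting an edge of a forest splits one block into two, so the sum is invariant down to the
    empty forest. *)
Lemma card_blocks F : forest F -> (#|blocks F| + #|F|)%N = #|T|.
Proof.
elim: {F}_.+1 {-2}F (ltnSn #|F|) => // m IH F; rewrite ltnS => Fm Ff.
have [->|[e eF]] := set_0Vmem F.
  by rewrite cards0 addn0 blocks0 card_imset //; apply: set1_inj.
have /complete_edgeP[x [y [nxy eE]]] : e \in complete_edges T.
  by move: Ff; rewrite inE => /andP[/subsetP/(_ e eF)].
rewrite eE in eF.
rewrite -(setD1K eF) -(IH (F :\ [set x; y])); last first.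
- exact: forest_sub (subsetDl _ _) Ff.
- by rewrite (cardsD1 [set x; y] F) eF in Fm.
rewrite (card_blocks_setU1 (forest_edge_disconnects Ff eF)).
by rewrite cardsU1 setD11 addnS addSn.
Qed.

Lemma ordered_pairs_edges (D : {set {set T}}) : D \subset complete_edges T ->
  (\sum_x \sum_y ([set x; y] \in D) = 2 * #|D|)%N.
Proof.
move=> /subsetP DK; rewrite pair_bigA /= -big_mkcond /=.
rewrite (partition_big (fun p : T * T => [set p.1; p.2]) (mem D)) //=.
rewrite mulnC -sum_nat_const; apply: eq_bigr => e eD.
have /complete_edgeP[u [v [nuv eE]]] := DK e eD.
rewrite sum1_card -[RHS](_ : #|[set (u, v); (v, u)]| = 2%N); last first.
  by rewrite cards2 xpair_eqE negb_and nuv.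
apply: eq_card => -[x y]; rewrite !inE unfold_in /= eE.
rewrite set2_eq !xpair_eqE; apply: andb_idl => E.
suff -> : [set x; y] = e by [].
by apply/eqP; rewrite eE set2_eq.
Qed.

(** Double counting of the pairs formed by a forest G counted in [nforests k F] and an orientation
    of an edge of G outside F. *)
Lemma nforests_rec k F : forest F -> (#|F| <= k)%N ->
  (\sum_x \sum_(y | ~~ conn F x y) nforests k ([set x; y] |: F)
   = 2 * (k - #|F|) * nforests k F)%N.
Proof.
move=> Ff Fk.
pose S := [set G in forests (complete_edges T) | (F \subset G) && (#|G| == k)].
transitivity (\sum_(G in S) \sum_x \sum_y ([set x; y] \in G :\: F))%N;
  last first.
  rewrite mulnC -sum_nat_const; apply: eq_bigr => G.
  rewrite !inE => /andP[/andP[GK _] /andP[FG /eqP Gk]].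
  rewrite ordered_pairs_edges ?cardsD ?(setIidPr FG) ?Gk //.
  by apply: subset_trans GK; apply: subsetDl.
(* An edge of the forest G outside F has its ends disconnected in F, as otherwise it would close a
   cycle in G. *)
have key G x y : G \in S ->
    ([set x; y] \in G :\: F) = ~~ conn F x y && ([set x; y] \in G).
  rewrite inE => /andP[Gf /andP[FG _]]; rewrite inE.
  case xyG: (_ \in G); rewrite ?andbF ?andbT //.
  apply/idP/idP => [xyF|/connP_neq[]//].
  apply: contra (forest_edge_disconnects Gf xyG); apply: conn_sub.
  by rewrite subsetD1 FG.
rewrite exchange_big /=; apply: eq_bigr => x _.
rewrite exchange_big /= big_mkcond /=; apply: eq_bigr => y _.
rewrite (eq_bigr _ (fun G GS => congr1 nat_of_bool (key G x y GS))).
case: ifP => nc /=; last by rewrite big1.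
rewrite -big_mkcondr /= sum1_card; apply: eq_card => G.
by rewrite [RHS]unfold_in /= !inE subUset sub1set; case: ([set x; y] \in G);
  rewrite ?andbT ?andbF.
Qed.

Lemma nforests_id F : forest F -> nforests #|F| F = 1%N.
Proof.
move=> Ff; rewrite -(cards1 F); apply: eq_card => G; rewrite !inE.
apply/idP/eqP => [/and3P[_ FG /eqP Gk]|->]; last first.
  by move: Ff; rewrite inE => ->; rewrite subxx eqxx.
by apply/esym/eqP; rewrite eqEcard FG Gk leqnn.
Qed.

Lemma nforests_eq0 k F : (k < #|F|)%N -> nforests k F = 0%N.
Proof.
move=> kF; apply: eq_card0 => G; rewrite !inE.
apply/negP => /and3P[_ /subset_leq_card FG /eqP Gk].
by move: kF; rewrite -Gk ltnNge FG.
Qed.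

End Counting.

(** * Closed formulas at both ends of the range of edge counts *)

Section Formulas.
Variables (R : numFieldType) (T : finType).
Implicit Types (F G : {set {set T}}) (x y u v : T) (A B : {set T}).

Local Notation forest F := (F \in forests (complete_edges T)).
Local Notation n := (#|T|%:R : R).

Definition csize F x : R := #|component F x|%:R.
Definition block_sum (g : R -> R) F : R := \sum_(A in blocks F) g #|A|%:R.
Definition block_prod F : R := \prod_(A in blocks F) #|A|%:R.

Local Notation c F := (block_sum (fun=> 1) F).
Local Notation S F := (block_sum (fun a => a^-1) F).
Local Notation p2 F := (block_sum (fun a => a ^+ 2) F).
Local Notation p4 F := (block_sum (fun a => a ^+ 4) F).

Lemma block_gt0 F A : A \in blocks F -> 0 < #|A|%:R :> R.
Proof.
move=> /imsetP[x _ ->]; rewrite ltr0n; apply/card_gt0P.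
by exists x; rewrite inE; apply: connect0.
Qed.

Lemma block_neq0 F A : A \in blocks F -> #|A|%:R != 0 :> R.
Proof. by move=> AF; rewrite gt_eqF // (block_gt0 AF). Qed.

Lemma csize_neq0 F x : csize F x != 0.
Proof. exact/block_neq0/mem_blocks. Qed.

Lemma block_sum1 F : c F = #|blocks F|%:R.
Proof. by rewrite /block_sum sumr_const. Qed.

Lemma block_sum_id F : block_sum id F = n.
Proof.
have := sum_vertices_blocks F (fun=> 1 : R).
rewrite sumr_const cardT -cardE => ->.
by apply: eq_bigr => A _; rewrite mulr1.
Qed.

Lemma block_sum_setU1 g F x y : ~~ conn F x y ->
  block_sum g ([set x; y] |: F) =
  block_sum g F - g (csize F x) - g (csize F y) + g (csize F x + csize F y).
Proof.
move=> nc; have /= := bigop_blocks_setU1 +%R (fun k => g k%:R) nc.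
rewrite natrD -/(csize F x) -/(csize F y) -!/(block_sum _ _) => E.
by apply: (addrI (g (csize F x) + g (csize F y))); rewrite E; ring.
Qed.

Lemma block_prod_setU1 F x y : ~~ conn F x y ->
  block_prod ([set x; y] |: F) =
  block_prod F * ((csize F x + csize F y) / (csize F x * csize F y)).
Proof.
move=> nc; have /= := bigop_blocks_setU1 *%R (fun k => k%:R : R) nc.
rewrite natrD -/(csize F x) -/(csize F y) -!/(block_prod _) => E.
apply: (mulfI (mulf_neq0 (csize_neq0 F x) (csize_neq0 F y))); rewrite E.
by field; rewrite !csize_neq0.
Qed.

Lemma block_sum_mul (g h : R -> R) F :
  \sum_(A in blocks F) \sum_(B in blocks F) g #|A|%:R * h #|B|%:R =
  block_sum g F * block_sum h F.
Proof. by rewrite /block_sum big_distrlr. Qed.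

(** The assumed shape of [a * b * phi a b] is the one met in the recursions for trees and 2-forests;
    it reduces the sum to n, the number of blocks and the sum of reciprocal sizes. *)
Lemma sum_disconnected_affine F (phi : R -> R -> R) (u v w : R) :
  (forall a b, 0 < a -> 0 < b ->
     a * b * phi a b = u * (a + b) + v + w * (a / b + b / a)) ->
  \sum_x \sum_(y | ~~ conn F x y) phi (csize F x) (csize F y) =
  2 * u * n * (c F - 1) + v * (c F ^+ 2 - c F) + 2 * w * (n * S F - c F).
Proof.
move=> phiE; rewrite sum_disconnected_pairs.
rewrite (_ : \sum_(A in blocks F) \sum_(B in blocks F) _ =
  u * (block_sum id F * c F + c F * block_sum id F) + v * (c F * c F)
  + w * (block_sum id F * S F + S F * block_sum id F)).
  rewrite (_ : \sum_(A in blocks F) _ =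
    2 * u * block_sum id F + (v + 2 * w) * c F).
    by rewrite block_sum_id; ring.
  rewrite /block_sum !mulr_sumr -big_split; apply: eq_bigr => A AF /=.
  have a0 := block_neq0 AF; rewrite expr2 phiE ?(block_gt0 AF) //.
  by field.
rewrite -!block_sum_mul -!big_split !mulr_sumr -!big_split /=.
apply: eq_bigr => A AF.
rewrite -!big_split !mulr_sumr -!big_split /=.
apply: eq_bigr => B BF; rewrite phiE ?(block_gt0 AF) ?(block_gt0 BF) //.
by field; rewrite ?(block_neq0 AF) ?(block_neq0 BF).
Qed.

Lemma sum_disconnected_product F (u v : R) :
  \sum_x \sum_(y | ~~ conn F x y) (u + v * (csize F x * csize F y)) =
  u * (n ^+ 2 - p2 F) + v * (p2 F ^+ 2 - p4 F).
Proof.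
rewrite (sum_disconnected_pairs F (fun a b => u + v * (a * b))).
rewrite (_ : \sum_(A in blocks F) \sum_(B in blocks F) _ =
  u * (block_sum id F * block_sum id F) + v * (p2 F * p2 F)).
  rewrite (_ : \sum_(A in blocks F) _ = u * p2 F + v * p4 F).
    by rewrite block_sum_id; ring.
  rewrite /block_sum !mulr_sumr -big_split; apply: eq_bigr => A AF /=.
  by ring.
rewrite -!block_sum_mul !mulr_sumr -!big_split /=.
apply: eq_bigr => A AF.
rewrite !mulr_sumr -!big_split /=.
by apply: eq_bigr => B BF; ring.
Qed.

Lemma nforests_recR k F : forest F -> (#|F| <= k)%N ->
  \sum_x \sum_(y | ~~ conn F x y) (nforests k ([set x; y] |: F))%:R
   = 2 * (k - #|F|)%:R * (nforests k F)%:R :> R.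
Proof.
move=> Ff Fk; rewrite -!natrM -nforests_rec // natr_sum.
by apply: eq_bigr => x _; rewrite natr_sum.
Qed.

(** With k = n - j the factor k - |F| equals c(F) - j, nonzero above j blocks, so the recursion
    determines the counts by induction on the number of blocks. At j blocks, F is the only forest
    counted. *)
Lemma nforests_formula (j : nat) (H : {set {set T}} -> R) :
  (forall F, forest F -> #|blocks F| = j -> H F = 1) ->
  (forall F, forest F -> (j < #|blocks F|)%N ->
    \sum_x \sum_(y | ~~ conn F x y) H ([set x; y] |: F) =
    2 * (c F - j%:R) * H F) ->
  forall F, forest F -> (j <= #|blocks F|)%N ->
    (nforests (#|T| - j)%N F)%:R = H F.
Proof.
move=> H1 Hrec F Ff jF; have [m mE] : {m | #|blocks F| = (m + j)%N}.
  by exists (#|blocks F| - j)%N; rewrite subnK.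
elim: m => [|m IH] in F Ff jF mE *.
  rewrite H1 // -(card_blocks Ff) mE add0n addKn.
  by rewrite nforests_id.
have FT := card_blocks Ff.
have E := nforests_recR Ff (_ : #|F| <= #|T| - j)%N.
rewrite -FT mE in E; rewrite -FT mE.
have nz : 2 * (m.+1 + j + #|F| - j - #|F|)%:R != 0 :> R.
  by rewrite -natrM pnatr_eq0; lia.
apply: (mulfI nz); rewrite -{}E; last by lia.
have -> : 2 * (m.+1 + j + #|F| - j - #|F|)%:R = 2 * (c F - j%:R) :> R.
  rewrite block_sum1 mE natrD addrK; congr (_ * _%:R); lia.
rewrite -Hrec //; last by lia.
apply: eq_bigr => x _; apply: eq_bigr => y nc.
have cU := card_blocks_setU1 nc.
by rewrite -IH ?forest_setU1 -?FT ?mE //; lia.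
Qed.

(** The quotient stands for the exponent c - 2, which is negative when F is already a spanning
    tree. *)
Lemma nforests_trees F : forest F -> (0 < #|T|)%N ->
  (nforests (#|T| - 1)%N F)%:R = block_prod F * n ^+ #|blocks F| / n ^+ 2.
Proof.
move=> Ff T0; have n0 : n != 0 by rewrite pnatr_eq0 -lt0n.
apply: (nforests_formula (j := 1)
  (H := fun F => block_prod F * n ^+ #|blocks F| / n ^+ 2))
  => // [{}F {}Ff /eqP|{}F {}Ff cF|].
- move=> /cards1P[A FE].
  have := block_sum_id F; rewrite /block_sum /block_prod FE !big_set1 cards1.
  move=> ->.
  by field.
(* [phi] is the formula at F + xy in terms of the merged sizes a and b: one power of n is lost and
   the product gains the factor (a + b) / (a b). *)
- pose u := block_prod F * n ^+ #|blocks F|.-1 / n ^+ 2.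
  pose phi (a b : R) := u * (a + b) / (a * b).
  transitivity (\sum_x \sum_(y | ~~ conn F x y) phi (csize F x) (csize F y)).
    apply: eq_bigr => x _; apply: eq_bigr => y nc.
    rewrite block_prod_setU1 // /phi /u (card_blocks_setU1 nc) /=.
    set P := _ ^+ #|_|; move: P (csize_neq0 F x) (csize_neq0 F y) => P.
    by move: (csize F x) (csize F y) => a b a0 b0; field; rewrite n0 a0 b0.
  rewrite (@sum_disconnected_affine F phi u 0 0); last first.
    by move=> a b a0 b0; rewrite /phi; field; rewrite !gt_eqF.
  have -> : n ^+ #|blocks F| = n * n ^+ #|blocks F|.-1.
    by rewrite -exprS prednK // (ltnW cF).
  rewrite /u.
  set P := _ ^+ _.-1; move: P => P.
  by field; rewrite n0.
- by have /card_gt0P[x _] := T0; apply/card_gt0P; exists (component F x);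
  apply: mem_blocks.
Qed.

Lemma nforests_2forests F : forest F -> (1 < #|blocks F|)%N ->
  (nforests (#|T| - 2)%N F)%:R = block_prod F * n ^+ #|blocks F| / n ^+ 4 *
    (n * S F - (c F - 2) * (c F - 3) / 2).
Proof.
move=> Ff c1; have n0 : n != 0.
  by rewrite pnatr_eq0 -lt0n -(card_blocks Ff) addn_gt0 (ltnW c1).
apply: (nforests_formula (j := 2) (H := fun F => block_prod F * n ^+ #|blocks F|
  / n ^+ 4 * (n * S F - (c F - 2) * (c F - 3) / 2)))
  => // [{F Ff c1}F Ff /eqP|{F Ff c1}F Ff cF].
(* For two blocks a + b = n, so n (1/a + 1/b) = n^2 / (a b) and the formula gives 1. *)
- move=> /cards2P[A [B [AB FE]]].
  have := block_sum_id F; rewrite block_sum1 /block_sum /block_prod FE.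
  rewrite cards2 AB !big_setU1 ?big_set1 ?inE //= => nE.
  have a0 : #|A|%:R != 0 :> R by apply: (@block_neq0 F); rewrite FE set21.
  have b0 : #|B|%:R != 0 :> R by apply: (@block_neq0 F); rewrite FE set22.
  by rewrite -nE in n0 *; field; rewrite a0 b0.
- pose u := block_prod F * n ^+ #|blocks F|.-1 / n ^+ 4.
  (* The last factor after a merge, with c lowered by one; the change of the reciprocal sum is left
     to [phi]. *)
  pose v := n * S F - (c F - 3) * (c F - 4) / 2.
  pose phi (a b : R) := u * (a + b) / (a * b) *
    (v + n * ((a + b)^-1 - a^-1 - b^-1)).
  transitivity (\sum_x \sum_(y | ~~ conn F x y) phi (csize F x) (csize F y)).
    apply: eq_bigr => x _; apply: eq_bigr => y nc.
    rewrite block_prod_setU1 // !block_sum_setU1 //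
      /phi /u /v (card_blocks_setU1 nc) /=.
    have ab0 : csize F x + csize F y != 0.
      by rewrite -natrD pnatr_eq0 addn_eq0 -(pnatr_eq0 R)
        (negbTE (csize_neq0 F x)).
    set P := _ ^+ #|_|; move: P (csize_neq0 F x) (csize_neq0 F y) ab0 => P.
    by move: (csize F x) (csize F y) => a b a0 b0 ab0; field;
      rewrite n0 ?a0 ?b0 ?ab0.
  (* The coefficients come from (a + b) (1/(a + b) - 1/a - 1/b) = -1 - a/b - b/a. *)
  rewrite (@sum_disconnected_affine F phi (u * v) (- n * u) (- n * u));
    last first.
    by move=> a b a0 b0; rewrite /phi; field; rewrite !gt_eqF // addr_gt0.
  have -> : n ^+ #|blocks F| = n * n ^+ #|blocks F|.-1.
    by rewrite -exprS prednK // (ltn_trans _ cF).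
  rewrite /u /v.
  set P := _ ^+ _.-1; move: P => P.
  by field; rewrite n0.
Qed.

(** The edges that extend F to a forest are the unordered pairs of vertices in different blocks. *)
Lemma nforests_succ F : forest F ->
  (nforests #|F|.+1 F)%:R = (n ^+ 2 - p2 F) / 2.
Proof.
move=> Ff; have := nforests_recR Ff (leqnSn _).
rewrite subSnn mulr1 => E; apply: (mulfI (_ : 2 != 0));
  first by rewrite pnatr_eq0.
rewrite -E.
have -> : 2 * ((n ^+ 2 - p2 F) / 2) =
  1 * (n ^+ 2 - p2 F) + 0 * (p2 F ^+ 2 - p4 F).
  by field.
rewrite -sum_disconnected_product.
apply: eq_bigr => x _; apply: eq_bigr => y nc.
have [_ xyF] := connP_neq nc.
rewrite (_ : #|F|.+1 = #|[set x; y] |: F|) ?nforests_id ?forest_setU1 //;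
  first by ring.
by rewrite cardsU1 xyF.
Qed.

Lemma nforests_succ2 F : forest F ->
  (nforests #|F|.+2 F)%:R =
  ((n ^+ 2 - p2 F) ^+ 2 / 2 - (p2 F ^+ 2 - p4 F)) / 4.
Proof.
move=> Ff; have := nforests_recR Ff (ltnW (leqnSn #|F|.+1)).
rewrite (_ : (_.+2 - _ = 2)%N); last by lia.
move=> E; apply: (mulfI (_ : 2 * 2 != 0)); first by rewrite -natrM pnatr_eq0.
rewrite -E.
transitivity ((n ^+ 2 - p2 F) / 2 * (n ^+ 2 - p2 F)
  (* Merging a and b raises the sum of squares by 2ab, so the one-step count at F + xy is (n^2 - p2)
     / 2 - ab. *)
  + (-1) * (p2 F ^+ 2 - p4 F)); last by field.
rewrite -sum_disconnected_product.
apply: eq_bigr => x _; apply: eq_bigr => y nc.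
have [_ xyF] := connP_neq nc.
rewrite (_ : #|F|.+2 = #|[set x; y] |: F|.+1); last by rewrite cardsU1 xyF.
rewrite nforests_succ ?forest_setU1 // block_sum_setU1 //.
by field.
Qed.

End Formulas.

(** * Signs of polynomials near zero *)

Section Small.
Variable R : realFieldType.

(** Near zero the lowest nonzero coefficient dominates. *)
Lemma poly_le0_near0 (p : {poly R}) k :
  (forall i, (i < k)%N -> p`_i = 0) -> p`_k < 0 ->
  exists2 d : R, 0 < d & forall x, 0 < x <= d -> p.[x] <= 0.
Proof.
move=> pi0 pk0; pose M := 1 + \sum_(i < size p) `|p`_i|.
have M0 : 0 < M by rewrite ltr_pwDl // sumr_ge0.
have ks : (k < size p)%N.
  by rewrite ltnNge; apply: contraTN pk0 => ?; rewrite nth_default ?ltxx.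
(* The bound 1 keeps every higher power of x below x^(k+1); the other bound gives x M <= -p_k. *)
exists (Num.min 1 (- p`_k / M)).
  by rewrite lt_min ltr01 divr_gt0 // oppr_gt0.
move=> x /andP[x0]; rewrite le_min ler_pdivlMr // => /andP[x1 xM].
rewrite horner_coef (bigD1 (Ordinal ks)) //=.
apply: le_trans (_ : p`_k * x ^+ k + x ^+ k * (x * M) <= 0); last first.
  by rewrite mulrC -mulrDr pmulr_rle0 ?exprn_gt0 //; lra.
rewrite lerD2l; apply: le_trans (_ : \sum_(i < size p) x ^+ k * x * `|p`_i|
    <= _).
  rewrite [leRHS](bigD1 (Ordinal ks)) //= ler_wpDl ?mulr_ge0 ?exprn_ge0
    ?(ltW x0) //.
  apply: ler_sum => i ik; have [/pi0->|ki] := ltnP i k.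
    by rewrite mul0r !mulr_ge0 ?exprn_ge0 ?(ltW x0).
  rewrite mulrC -exprSr.
  apply: le_trans (_ : x ^+ i * `|p`_i| <= _).
    by rewrite ler_wpM2l ?exprn_ge0 ?(ltW x0) ?ler_norm.
  rewrite ler_wpM2r // ler_wiXn2l ?(ltW x0) //.
  rewrite ltn_neqAle ki andbT eq_sym.
  by apply: contraNneq ik => ik; apply/eqP/val_inj.
rewrite -mulr_sumr mulrA ler_wpM2l ?mulr_ge0 ?exprn_ge0 ?(ltW x0) //.
by rewrite lerDr ler01.
Qed.

Lemma fin_uniform_near0 (I : finType) (P : I -> R -> Prop) :
  (forall i, exists2 d : R, 0 < d & forall x, 0 < x <= d -> P i x) ->
  exists2 d : R, 0 < d & forall i x, 0 < x <= d -> P i x.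
Proof.
(* The base value 1 keeps the minimum positive even for an empty index type. *)
move=> /fin_all_exists2[f f0 fP]; exists (\big[Num.min/1]_i f i).
  by apply/bigmin_gtP; split.
by move=> i x /andP[x0 xf]; apply: fP; rewrite x0 (le_trans xf) // bigmin_le.
Qed.
End Small.

(** * Block statistics for no edge, one edge and two edges *)

Section Config.
Variables (R : numFieldType) (T : finType).
Implicit Types (F G : {set {set T}}) (x y u v : T) (A B : {set T}).
Local Notation forest F := (F \in forests (complete_edges T)).
Local Notation n := (#|T|%:R : R).

Lemma conn0 x y : conn set0 x y = (x == y).
Proof.
apply/idP/eqP => [/connectP[[|w p] /=]|->]; last exact: connect0.
  by move=> _ ->.
by rewrite /edge_rel inE.
Qed.

Lemma csize0 x : csize R set0 x = 1.
Proof.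
rewrite /csize (_ : component set0 x = [set x]) ?cards1 //.
by apply/setP => z; rewrite !inE conn0 eq_sym.
Qed.

Lemma component1 x y z :
  component [set [set x; y]] z =
  if z \in [set x; y] then [set x; y] else [set z].
Proof.
apply/setP => w; rewrite -[[set [set x; y]]]setU0 inE conn_setU1 !conn0 !inE.
rewrite [y == w]eq_sym [x == w]eq_sym [z == w]eq_sym.
have [->|_] := eqVneq z x; rewrite /= ?inE.
  by case: (w == x) => //=; rewrite andbF orbF.
by have [->|_] := eqVneq z y; rewrite /= ?orbF !inE // orbC.
Qed.

Lemma csize1 x y z : x != y -> csize R [set [set x; y]] z =
  if z \in [set x; y] then 2 else 1.
Proof.
by move=> nxy; rewrite /csize component1; case: ifP => _;
  rewrite ?cards1 ?cards2 ?nxy.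
Qed.

Lemma forest0 : forest (set0 : {set {set T}}).
Proof. exact: forests0. Qed.

Lemma block_sum0 g : block_sum g (set0 : {set {set T}}) = n * g 1 :> R.
Proof.
rewrite /block_sum blocks0 big_imset /= => [|x y _ _]; last exact: set1_inj.
under eq_bigr do rewrite cards1.
by rewrite sumr_const mulr_natl.
Qed.

Lemma block_prod0 : block_prod R (set0 : {set {set T}}) = 1 :> R.
Proof.
rewrite /block_prod blocks0 big_imset /= => [|x y _ _]; last exact: set1_inj.
by rewrite big1 // => x _; rewrite cards1.
Qed.

Section OneEdge.
Variables (x y : T) (nxy : x != y).
Let e := [set x; y].

Let nc0 : ~~ conn set0 x y. Proof. by rewrite conn0. Qed.

Lemma forest1 : forest [set e].
Proof. by rewrite -[[set e]]setU0 forest_setU1 // forest0. Qed.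

Lemma block_sum_edge g : block_sum g [set e] = (n - 2) * g 1 + g 2.
Proof.
by rewrite -[[set e]]setU0 block_sum_setU1 // block_sum0 !csize0; ring.
Qed.

Lemma block_prod_edge : block_prod R [set e] = 2.
Proof.
by rewrite -[[set e]]setU0 block_prod_setU1 // block_prod0 !csize0; field.
Qed.

End OneEdge.

Section TwoEdges.
Variables (x y z w : T) (nxy : x != y) (nzw : z != w).
Let e := [set x; y].
Let f := [set z; w].
Hypothesis we : w \notin e.

Let nc1 : ~~ conn [set e] z w.
Proof.
rewrite -component_eq !component1 (negbTE we); apply/eqP/setP.
case: ifP => _ /(_ w); last by rewrite !inE eqxx eq_sym (negbTE nzw).
by rewrite (negbTE we) set11.
Qed.

Lemma forest2 : forest [set f; e].
Proof. by rewrite forest_setU1 // forest1. Qed.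

Lemma card_edges2 : #|[set f; e]| = 2%N.
Proof. by rewrite cards2; have [_ /=] := connP_neq nc1; rewrite inE => ->. Qed.

(** Since w is off e, [z \in e] means that the edges are adjacent and form one block of size 3;
    otherwise they form two blocks of size 2. *)
Lemma block_sum_edges g : block_sum g [set f; e] =
  if z \in e then (n - 3) * g 1 + g 3 else (n - 4) * g 1 + 2 * g 2.
Proof.
rewrite block_sum_setU1 // block_sum_edge // !csize1 // (negbTE we).
case: ifP => _.
  by rewrite (_ : 2 + 1 = 3); ring.
by rewrite (_ : 1 + 1 = 2); ring.
Qed.

Lemma block_prod_edges : block_prod R [set f; e] = if z \in e then 3 else 4.
Proof.
rewrite block_prod_setU1 // block_prod_edge // !csize1 // (negbTE we).
by case: ifP => _; field.
Qed.

End TwoEdges.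

End Config.

(** * Generating polynomials and their extreme coefficients *)

Section Polys.
Variables (R : realFieldType) (T : finType).
Implicit Types (F G : {set {set T}}) (x y u v : T) (A B : {set T}).
Local Notation forest F := (F \in forests (complete_edges T)).
Local Notation n := (#|T|%:R : R).

(** A forest has fewer edges than vertices, so the degree bound cuts off no forest. *)
Definition forest_poly F : {poly R} :=
  \poly_(k < #|T|) (nforests k F)%:R.

(* Weights a forest G by the number n - 1 - |G| of edges it lacks to be a
   spanning tree, so that large beta becomes a neighbourhood of 0. *)
Definition coforest_poly F : {poly R} :=
  \poly_(k < #|T|) (nforests (#|T| - 1 - k)%N F)%:R.

Lemma card_forest F : forest F -> (0 < #|T|)%N -> (#|F| < #|T|)%N.
Proof.
move=> Ff /card_gt0P[x _]; rewrite -(card_blocks Ff) -addn1 addnC leq_add2r.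
by apply/card_gt0P; exists (component F x); apply: mem_blocks.
Qed.

Lemma horner_forest_poly F b : (0 < #|T|)%N ->
  (forest_poly F).[b] =
  \sum_(G in forests (complete_edges T) | F \subset G) b ^+ #|G|.
Proof.
(* The default of [insubd] is never taken on a forest, by [card_forest]. *)
move=> T0; pose h G : 'I_#|T| := insubd (Ordinal T0) #|G|.
rewrite horner_poly (partition_big h xpredT) //=; apply: eq_bigr => k _.
rewrite (eq_bigr (fun=> b ^+ k)) => [|G /andP[/andP[Gf _] /eqP <-]]; last first.
  by rewrite /h val_insubd card_forest.
rewrite sumr_const mulr_natl; congr (_ *+ _); apply: eq_card => G.
rewrite [RHS]unfold_in /= inE andbA; apply: andb_id2l => /andP[Gf _].
by rewrite -val_eqE /h /= val_insubd card_forest.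
Qed.

(** The two polynomials have reversed coefficient lists. *)
Lemma horner_coforest_poly F b : (0 < #|T|)%N -> b != 0 ->
  b ^+ (#|T| - 1)%N * (coforest_poly F).[b^-1] = (forest_poly F).[b].
Proof.
move=> T0 b0; rewrite !horner_poly mulr_sumr (reindex_inj rev_ord_inj) /=.
apply: eq_bigr => k _; have kT := ltn_ord k.
have E1 m i : (i < m -> m - 1 - (m - i.+1) = i)%N by lia.
have E2 m i : (i < m -> m - 1 = i + (m - i.+1))%N by lia.
rewrite (E1 _ _ kT) mulrCA; congr (_ * _); rewrite (E2 _ _ kT).
by rewrite exprD exprVn mulfK // expf_neq0.
Qed.

Section Pair.
Variables (x y z w : T) (nxy : x != y) (nzw : z != w).
Let e := [set x; y].
Let f := [set z; w].
Hypotheses (we : w \notin e) (T5 : (4 < #|T|)%N).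

Lemma nforests_empty_0 : (nforests 0 (set0 : {set {set T}}))%:R = 1 :> R.
Proof. by have := nforests_id (@forest0 T); rewrite cards0 => ->. Qed.

Lemma nforests_empty_1 : (nforests 1 (set0 : {set {set T}}))%:R =
  (n ^+ 2 - n) / 2 :> R.
Proof.
have := nforests_succ R (@forest0 T); rewrite cards0 => ->.
by rewrite block_sum0; ring.
Qed.

Lemma nforests_empty_2 : (nforests 2 (set0 : {set {set T}}))%:R =
  ((n ^+ 2 - n) ^+ 2 / 2 - (n ^+ 2 - n)) / 4 :> R.
Proof.
have := nforests_succ2 R (@forest0 T); rewrite cards0 => ->.
by rewrite !block_sum0; ring.
Qed.

Lemma nforests_edge_1 u v : u != v -> (nforests 1 [set [set u; v]])%:R = 1 :> R.
Proof. by move=> uv; have := nforests_id (forest1 uv); rewrite cards1 => ->.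
Qed.

Lemma nforests_edge_2 u v : u != v ->
  (nforests 2 [set [set u; v]])%:R = (n ^+ 2 - n - 2) / 2 :> R.
Proof.
move=> uv; have := nforests_succ R (forest1 uv); rewrite cards1 => ->.
by rewrite block_sum_edge //; ring.
Qed.

Lemma nforests_edge_3 u v : u != v -> (nforests 3 [set [set u; v]])%:R =
  ((n ^+ 2 - n - 2) ^+ 2 / 2 - ((n + 2) ^+ 2 - n - 14)) / 4 :> R.
Proof.
move=> uv; have := nforests_succ2 R (forest1 uv); rewrite cards1 => ->.
by rewrite !block_sum_edge //; ring.
Qed.

Lemma nforests_edges_2 : (nforests 2 [set f; e])%:R = 1 :> R.
Proof.
by have := nforests_id (forest2 nxy nzw we); rewrite (card_edges2 nzw we) => ->.
Qed.

Lemma nforests_edges_3 : (nforests 3 [set f; e])%:R =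
  (n ^+ 2 - n - (if z \in e then 6 else 4)) / 2 :> R.
Proof.
have := nforests_succ R (forest2 nxy nzw we);
  rewrite (card_edges2 nzw we) => ->.
by rewrite block_sum_edges //; case: ifP => _; ring.
Qed.

Lemma nforests_edges_4 : z \notin e -> (nforests 4 [set f; e])%:R =
  ((n ^+ 2 - n - 4) ^+ 2 / 2 - ((n + 4) ^+ 2 - n - 28)) / 4 :> R.
Proof.
move=> /negbTE ze.
have := nforests_succ2 R (forest2 nxy nzw we);
  rewrite (card_edges2 nzw we) => ->.
by rewrite !block_sum_edges // ze; ring.
Qed.

Lemma forest_poly_pair : exists2 d : R, 0 < d & forall b, 0 < b <= d ->
  (forest_poly [set f; e] * forest_poly set0 -
   forest_poly [set e] * forest_poly [set f]).[b] <= 0.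
Proof.
(* Coefficients up to degree 4 are needed; [T5] places them all below the degree bound. *)
have cE k F : (k < 5)%N -> (forest_poly F)`_k = (nforests k F)%:R.
  by move=> k5; rewrite coef_poly (leq_trans k5 T5).
have n1 u v : nforests 0 [set [set u; v] : {set T}] = 0%N.
  by rewrite nforests_eq0 ?cards1.
have n20 : (nforests 0 [set f; e] = 0)%N.
  by rewrite nforests_eq0 ?(card_edges2 nzw we).
have n21 : (nforests 1 [set f; e] = 0)%N.
  by rewrite nforests_eq0 ?(card_edges2 nzw we).
case: (boolP (z \in e)) => ze; have cnt3 := nforests_edges_3;
  rewrite ?ze ?(negbTE ze) in cnt3.
(* Adjacent edges: degree 2 cancels as 1 - 1, and the coefficient of degree 3 is -3 + 2 = -1. *)
- apply: (@poly_le0_near0 _ _ 3) => [[|[|[|//]]] _|];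
    rewrite coefB !coefM !big_ord_recr !big_ord0 /= !cE // ?n1 ?n20 ?n21
      ?nforests_empty_0 ?nforests_empty_1 ?nforests_empty_2 ?nforests_edge_1
        ?nforests_edge_2 // ?nforests_edges_2 ?cnt3; try ring.
  lra.
(* Disjoint edges: degree 3 now cancels as -2 + 2. *)
- apply: (@poly_le0_near0 _ _ 4) => [[|[|[|[|//]]]] _|];
    rewrite coefB !coefM !big_ord_recr !big_ord0 /= !cE // ?n1 ?n20 ?n21
      ?nforests_empty_0 ?nforests_empty_1 ?nforests_empty_2 ?nforests_edge_1
        ?nforests_edge_2 // ?nforests_edges_2 ?cnt3 ?nforests_edge_3 //
        ?nforests_edges_4 //; try ring; try field.
  nra.
Qed.

(** Pulls the common power n^|T| out of all counts, leaving rational identities in n. *)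
Lemma blocks_pow F : forest F -> n ^+ #|blocks F| = n ^+ #|T| / n ^+ #|F|.
Proof.
move=> Ff; rewrite -{3}(card_blocks Ff) exprD mulfK // expf_neq0 //.
by rewrite pnatr_eq0; lia.
Qed.

Lemma coforest_poly_pair : exists2 d : R, 0 < d & forall b, 0 < b <= d ->
  (coforest_poly [set f; e] * coforest_poly set0 -
   coforest_poly [set e] * coforest_poly [set f]).[b] <= 0.
Proof.
have T0 : (0 < #|T|)%N by apply: leq_trans T5.
have n0 : n != 0 by rewrite pnatr_eq0 -lt0n.
have c0 F : (coforest_poly F)`_0 = (nforests (#|T| - 1)%N F)%:R.
  by rewrite coef_poly T0 subn0.
have c1 F : (coforest_poly F)`_1 = (nforests (#|T| - 2)%N F)%:R.
  by rewrite coef_poly (leq_trans _ T5) // -subnDA.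
have cb F : forest F -> (#|F| <= 2)%N -> (1 < #|blocks F|)%N.
  by move=> /card_blocks; lia.
pose P := n ^+ #|T|.
have P0 : 0 < P by rewrite exprn_gt0 // ltr0n.
case: (boolP (z \in e)) => ze.
- apply: (@poly_le0_near0 _ _ 0) => //.
  rewrite coefB !coefM !big_ord_recr !big_ord0 /= !c0 add0r.
  rewrite !nforests_trees ?forest0 ?forest1 ?forest2 //
    !blocks_pow ?forest0 ?forest1 ?forest2 //.
  rewrite block_prod0 !block_prod_edge // block_prod_edges //
    ze cards0 !cards1 card_edges2 // -/P.
  (* The block products enter as 3 * 1 - 2 * 2 = -1. *)
  rewrite [ltLHS](_ : _ = - (P ^+ 2 / n ^+ 6)).
    by rewrite oppr_lt0 divr_gt0 ?exprn_gt0 // ltr0n.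
  by field.
- apply: (@poly_le0_near0 _ _ 1) => [[|//] _|];
    rewrite coefB !coefM !big_ord_recr !big_ord0 /= !c0 ?c1 add0r;
    rewrite !nforests_trees ?forest0 ?forest1 ?forest2 //.
    rewrite !blocks_pow ?forest0 ?forest1 ?forest2 //.
    rewrite block_prod0 !block_prod_edge // block_prod_edges //
      (negbTE ze) cards0 !cards1 card_edges2 // -/P.
    by field.
  rewrite !nforests_2forests ?cb ?forest0 ?forest1 ?forest2 ?cards0 ?cards1
    ?card_edges2 //.
  rewrite !blocks_pow ?forest0 ?forest1 ?forest2 //.
  rewrite !block_sum0 !block_sum_edge // !block_sum_edges //.
  rewrite block_prod0 !block_prod_edge // block_prod_edges //
    (negbTE ze) cards0 !cards1 card_edges2 // -/P.
  (* The reciprocal sums n, n - 3/2, n - 3 have second difference zero, so only the binomial term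
     contributes. *)
  rewrite [ltLHS](_ : _ = - (4 * P ^+ 2 / n ^+ 8)).
    by rewrite oppr_lt0 divr_gt0 ?mulr_gt0 ?exprn_gt0 // ltr0n.
  by field.
Qed.

End Pair.
End Polys.

(** Labels an endpoint of [e2] outside [e1] as w, which leaves only the position of z to be
    distinguished. *)
Lemma distinct_edges_cases (T : finType) (e1 e2 : {set T}) :
  e1 \in complete_edges T -> e2 \in complete_edges T -> e1 != e2 ->
  exists x y z w, [/\ x != y, z != w, e1 = [set x; y],
    e2 = [set z; w] & w \notin e1].
Proof.
move=> e1K e2K n12; have [x [y [nxy e1E]]] := complete_edgeP e1K.
have [z [w [nzw e2E]]] := complete_edgeP e2K.
have [we|we] := boolP (w \in e1); last by exists x, y, z, w.
exists x, y, w, z; split => //; first by rewrite eq_sym.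
  by rewrite setUC.
apply: contraNN n12 => ze; rewrite eq_sym eqEcard.
move: e1K e2K; rewrite !inE => /eqP-> /eqP->; rewrite leqnn andbT e2E.
by rewrite subUset !sub1set ze we.
Qed.

(** * Transfer to the arboreal gas *)

Section Probability.
Variables (R : realType) (T : finType).
Hypothesis T5 : (4 < #|T|)%N.

Let T0 : (0 < #|T|)%N. Proof. exact: leq_trans T5. Qed.

Lemma ag_edges_horner (b : R) (es : seq {set T}) :
  ag_edges (complete_edges T) b es =
  (forest_poly R [set e in es]).[b] /
    (forest_poly R (set0 : {set {set T}})).[b].
Proof.
rewrite /ag_edges /ag_prob /ag_mass -mulr_suml !horner_forest_poly //.
congr (_ / _); last by apply: eq_bigl => F; rewrite sub0set andbT.
apply: eq_bigl => F; congr (_ && _); apply/allP/subsetP => H e.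
  by rewrite inE; apply: H.
by move=> ees; apply: H; rewrite inE.
Qed.

Lemma horner_forest_poly0_gt0 (b : R) : 0 < b ->
  0 < (forest_poly R (set0 : {set {set T}})).[b].
Proof.
move=> b0; rewrite horner_forest_poly //;
  have := ag_partition_gt0 (complete_edges T) b0.
by congr (_ < _); apply: eq_bigl => F; rewrite sub0set andbT.
Qed.

(** Both sides are multiplied by the square of the positive partition function. *)
Lemma ag_edges_neg_cor (b : R) e1 e2 : 0 < b ->
  (ag_edges (complete_edges T) b [:: e1; e2] <=
    ag_edges (complete_edges T) b [:: e1] *
      ag_edges (complete_edges T) b [:: e2]) =
  ((forest_poly R [set e2; e1] * forest_poly R (set0 : {set {set T}}) -
    forest_poly R [set e1] * forest_poly R [set e2]).[b] <= 0).
Proof.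
move=> b0; have Z0 := horner_forest_poly0_gt0 b0; rewrite !ag_edges_horner.
have -> : [set e in [:: e1; e2]] = [set e2; e1].
  by apply/setP => e; rewrite !inE orbC.
have s1 e : [set e' in [:: e]] = [set e] by apply/setP => e'; rewrite !inE.
rewrite !s1 hornerD hornerN !hornerM subr_le0.
move: Z0; set Z := (forest_poly R set0).[b] => Z0.
by rewrite mulrACA -[in RHS]ler_pdivlMr // mulrA ler_pM2r // invr_gt0.
Qed.

Lemma neg_cor_extremes : exists2 d : R, 0 < d & forall b, 0 < b ->
  (b <= d) || (d^-1 <= b) -> forall e1 e2 : {set T},
  e1 \in complete_edges T -> e2 \in complete_edges T -> e1 != e2 ->
  ag_edges (complete_edges T) b [:: e1; e2] <=
    ag_edges (complete_edges T) b [:: e1] *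
      ag_edges (complete_edges T) b [:: e2].
Proof.
(* Being vacuous unless p consists of two distinct edges, [P] makes sense on the whole finite type
   of pairs, which yields one d for all edges and both ends. *)
pose P (p : {set T} * {set T}) (b : R) :=
  p.1 \in complete_edges T -> p.2 \in complete_edges T -> p.1 != p.2 ->
  (forest_poly R [set p.2; p.1] * forest_poly R (set0 : {set {set T}}) -
    forest_poly R [set p.1] * forest_poly R [set p.2]).[b] <= 0 /\
  (coforest_poly R [set p.2; p.1] * coforest_poly R (set0 : {set {set T}}) -
    coforest_poly R [set p.1] * coforest_poly R [set p.2]).[b] <= 0.
have [|d d0 dP] := @fin_uniform_near0 R _ P.
  case=> e1 e2; rewrite /P /=.
  have [e1K|] := boolP (e1 \in _); last by exists 1.
  have [e2K|] := boolP (e2 \in _); last by exists 1.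
  have [|n12] := boolP (e1 == e2); first by exists 1.
  have [x [y [z [w [nxy nzw -> -> we]]]]] := distinct_edges_cases e1K e2K n12.
  have [d d0 dP] := forest_poly_pair R nxy nzw we T5.
  have [d' d'0 d'P] := coforest_poly_pair R nxy nzw we T5.
  exists (Num.min d d'); first by rewrite lt_min d0.
  move=> b /andP[b0]; rewrite le_min => /andP[bd bd'] _ _ _.
  by split; [apply: dP | apply: d'P]; apply/andP.
exists d => // b b0 bd e1 e2 e1K e2K n12; rewrite ag_edges_neg_cor //.
case/orP: bd => bd.
  by have [] := dP (e1, e2) b; rewrite ?b0.
have [|//|//|//|_] := dP (e1, e2) b^-1.
  by rewrite invr_gt0 b0 -[d]invrK lef_pV2 ?posrE ?invr_gt0.
rewrite /= !(hornerD, hornerN, hornerM).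
rewrite -!(@horner_coforest_poly _ _ _ b) ?gt_eqF // => H.
(* For large b, reversal turns the difference into a positive power of b times its coforest analogue
   at 1/b <= d. *)
rewrite [leLHS](_ : _ = (b ^+ (#|T| - 1)%N) ^+ 2 *
  ((coforest_poly R [set e2; e1]).[b^-1] *
   (coforest_poly R (set0 : {set {set T}})).[b^-1] -
   (coforest_poly R [set e1]).[b^-1] * (coforest_poly R [set e2]).[b^-1]));
  last by ring.
by rewrite pmulr_rle0 // !exprn_gt0.
Qed.

End Probability.

Theorem theorem2p2 (R : realType) :
  exists N : nat, forall n : nat, (N <= n)%N ->
    exists beta_minus beta_plus : R,
      [/\ 0 < beta_minus, beta_minus <= beta_plus &
        forall beta : R, 0 < beta ->
          (beta <= beta_minus) || (beta_plus <= beta) ->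
          forall e1 e2 : {set 'I_n},
            e1 \in complete_edges 'I_n -> e2 \in complete_edges 'I_n ->
            e1 != e2 ->
            ag_edges (complete_edges 'I_n) beta [:: e1; e2] <=
            ag_edges (complete_edges 'I_n) beta [:: e1] *
            ag_edges (complete_edges 'I_n) beta [:: e2]].
Proof.
exists 5%N => n n5.
have [|d d0 dP] := @neg_cor_extremes R 'I_n; first by rewrite card_ord.
(* Cutting at 1 orders the thresholds even when d exceeds 1. *)
exists (Num.min d 1), (Num.max d^-1 1); split.
- by rewrite lt_min d0 ltr01.
- by rewrite ge_min !le_max lexx !orbT.
- move=> b b0 bd; apply: dP => //.
  by move: bd; rewrite le_min ge_max => /orP[]/andP[-> _]; rewrite ?orbT.
Qed.
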